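(* For every $\epsilon>0$ and every positive integer $L$ there is a positive integer $M$ such that, for all $n\ge M$, every real $n\times n$ matrix $A$ has a symmetric $(\epsilon)$-regular block partition $(\mathcal P,\mathcal P)$ with $|\mathcal P|\in[L,M]$.
   Context: Let $A=(a_{xy})$ be a real matrix with rows indexed by a finite set $V$ and columns indexed by a finite set $W$ (here $V=W$). Write $\|A\|=\sum_{x,y}|a_{xy}|$. For nonempty $X\subset V$, $Y\subset W$, the density is $d_A(X,Y)=\frac{1}{|X||Y|}\sum_{x\in X,y\in Y}a_{xy}$. The block $(X,Y)$ is $\epsilon$-regular if for all $X'\subset X$, $Y'\subset Y$ with $|X'|\ge\epsilon|X|$, $|Y'|\ge\epsilon|Y|$ we have $|d_A(X',Y')-d_A(X,Y)|\le\epsilon$. A block partition $(\mathcal P,\mathcal Q)$ consists of a partition $\mathcal P$ of $V$ and a partition $\mathcal Q$ of $W$ with designated (possibly empty) exceptional classes $V_0\in\mathcal P$, $W_0\in\mathcal Q$; its nonexceptional blocks are $(X,Y)$ with $X\in\mathcal P\setminus\{V_0\}$, $Y\in\mathcal Q\setminus\{W_0\}$. It is symmetric if $V=W$, $\mathcal P=\mathcal Q$ and $V_0=W_0$. $|\mathcal P|$ is the number of nonexceptional classes of $\mathcal P$. A partition with exceptional set is balanced if all nonexceptional classes have equal size. The block partition is $\epsilon$-regular if $\mathcal P,\mathcal Q$ are balanced, $|V_0|<\epsilon|V|$, $|W_0|<\epsilon|W|$, and all but at most $\epsilon|\mathcal P||\mathcal Q|$ nonexceptional blocks are $\epsilon$-regular;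 it is $(\epsilon)$-regular if it is an $\epsilon$-regular block partition of $A^*=\frac{|V||W|}{\|A\|}A$. *)

(* Defs.v *)
From mathcomp Require Import all_boot all_order all_algebra.
From mathcomp Require Import reals.

Set Implicit Arguments.
Unset Strict Implicit.
Unset Printing Implicit Defensive.

Import Order.TTheory GRing.Theory Num.Theory.
Local Open Scope ring_scope.

Definition l1norm (R : realType) (m n : nat) (A : 'M[R]_(m, n)) : R :=
  \sum_x \sum_y `|A x y|.

(* Only meaningful for nonempty X and Y; the value is 0 otherwise. *)
Definition density (R : realType) (m n : nat) (A : 'M[R]_(m, n))
    (X : {set 'I_m}) (Y : {set 'I_n}) : R :=
  (#|X| * #|Y|)%:R^-1 * \sum_(x in X) \sum_(y in Y) A x y.

(* When X and Y are nonempty and 0 < eps, the size conditions force X' and Y'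
   to be nonempty. *)
Definition regular_block (R : realType) (eps : R) (m n : nat)
    (A : 'M[R]_(m, n)) (X : {set 'I_m}) (Y : {set 'I_n}) : bool :=
  [forall X' : {set 'I_m}, forall Y' : {set 'I_n},
    [&& X' \subset X, Y' \subset Y,
        eps * #|X|%:R <= #|X'|%:R & eps * #|Y|%:R <= #|Y'|%:R] ==>
    (`|density A X' Y' - density A X Y| <= eps)].

(* A partition of T with a designated exceptional class, which may be empty.
   The exceptional class is kept out of [classes], so #|classes P| counts the
   nonexceptional classes, all of which are nonempty by [partition]. *)
Record xpartition (T : finType) := XPartition {
  exceptional : {set T};
  classes : {set {set T}};
  xpartitionP : partition classes (~: exceptional)
}.

Definition balanced (T : finType) (P : xpartition T) : Prop :=
  {in classes P &, forall X Y : {set T}, #|X| = #|Y|}.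

Definition block_partition (m n : nat) : Type :=
  (xpartition 'I_m * xpartition 'I_n)%type.

Definition symmetric_partition (n : nat) (B : block_partition n n) : Prop :=
  classes B.1 = classes B.2 /\ exceptional B.1 = exceptional B.2.

Definition irregular_blocks (R : realType) (eps : R) (m n : nat)
    (A : 'M[R]_(m, n)) (B : block_partition m n) :
    {set {set 'I_m} * {set 'I_n}} :=
  [set XY in setX (classes B.1) (classes B.2)
    | ~~ regular_block eps A XY.1 XY.2].

Definition regular_partition (R : realType) (eps : R) (m n : nat)
    (A : 'M[R]_(m, n)) (B : block_partition m n) : Prop :=
  [/\ balanced B.1, balanced B.2,
      #|exceptional B.1|%:R < eps * m%:R,
      #|exceptional B.2|%:R < eps * n%:R &
      #|irregular_blocks eps A B|%:R
        <= eps * (#|classes B.1| * #|classes B.2|)%:R].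

(* The matrix A^* = (m n / ||A||) A. For A = 0 this is 0, as _ / 0 = 0. *)
Definition normalized (R : realType) (m n : nat) (A : 'M[R]_(m, n)) :
    'M[R]_(m, n) :=
  ((m * n)%:R / l1norm A) *: A.

(* "(eps)-regular", as opposed to "eps-regular". *)
Definition normalized_regular_partition (R : realType) (eps : R) (m n : nat)
    (A : 'M[R]_(m, n)) (B : block_partition m n) : Prop :=
  regular_partition eps (normalized A) B.

(* Main.v *)
(* The proof is an energy increment with a truncated quadratic energy, which
   replaces the boundedness of the entries. For a function [rho] on the index
   pairs put [energy rho = sum (2 rho a - rho^2)]. Among the [rho] that are
   constant on the blocks of a partition and bounded by [D], the energy is
   maximised by the block means clipped to [[-D, D]]; the maximum therefore
   grows under refinement, and it is at most [2 D ||A||]. Few blocks have a mean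
   larger than [8 / eps], since the means are controlled by [||A||]. On any other
   irregular block, moving [rho] by [eps] towards the mean over a witness
   [X' * Y'] gains energy, so refining by all witnesses gains at least
   [eps^5 n^2 / 8], and this happens boundedly often. Points outside the classes
   are treated as singletons, so that recutting the refinement into classes of
   equal size is again a refinement. *)
Require Import Defs.
From mathcomp Require Import all_boot all_order all_algebra.
From mathcomp Require Import reals ring lra zify.

Set Implicit Arguments.
Unset Strict Implicit.
Unset Printing Implicit Defensive.

Import Order.TTheory GRing.Theory Num.Theory.
Local Open Scope ring_scope.

(** * Clipping, fibre means and the truncated energy *)

Definition clip (R : realType) (D s : R) : R := Num.max (- D) (Num.min D s).

Lemma clip_bound (R : realType) (D s : R) : 0 <= D -> `|clip D s| <= D.
Proof.
move=> D0; rewrite /clip ler_norml.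
by case: (leP (- D) (Num.min D s)); case: (leP D s) => ? ?; apply/andP; split; lra.
Qed.

Lemma clip_id (R : realType) (D s : R) : `|s| <= D -> clip D s = s.
Proof.
rewrite /clip ler_norml => /andP[s1 s2].
by rewrite (min_idPr s2) (max_idPr s1).
Qed.

(** Since [2 r s - r^2 = s^2 - (r - s)^2], this holds because [clip D s] is the point of [[-D, D]]
    nearest to [s]. *)
Lemma clip_max (R : realType) (D r s : R) : `|r| <= D ->
  2 * r * s - r ^+ 2 <= 2 * clip D s * s - clip D s ^+ 2.
Proof.
rewrite /clip ler_norml => /andP[r1 r2].
by case: (leP (- D) (Num.min D s)); case: (leP D s) => Ds sD;
  [have : 0 <= (D - r) * (2 * s - D - r) by apply: mulr_ge0; lra
  |have := sqr_ge0 (r - s)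
  |
  |have : 0 <= (D + r) * (r - D - 2 * s) by apply: mulr_ge0; lra]; nra.
Qed.

Definition mean (R : realType) (T : finType) (a : T -> R) (S : {set T}) : R :=
  #|S|%:R^-1 * \sum_(p in S) a p.

Definition fiber (T I : finType) (l : T -> I) (i : I) : {set T} :=
  [set p | l p == i].

(** Equal to [sum (a^2 - (a - rho)^2)]: the drop in squared error when [rho] replaces [0] as an
    approximation of [a]. *)
Definition energy (R : realType) (T : finType) (a rho : T -> R) : R :=
  \sum_p (2 * rho p * a p - rho p ^+ 2).

Definition clipped_mean (R : realType) (T I : finType) (D : R) (a : T -> R)
    (l : T -> I) (p : T) : R := clip D (mean a (fiber l (l p))).

Lemma sum_mean (R : realType) (T : finType) (a : T -> R) (S : {set T}) :
  \sum_(p in S) a p = #|S|%:R * mean a S.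
Proof.
rewrite /mean; have [->|S0] := eqVneq S set0; first by rewrite big_set0 cards0 mul0r.
by rewrite mulVKf // pnatr_eq0 cards_eq0.
Qed.

Lemma sum_fiber_mean (R : realType) (T I : finType) (a rho : T -> R) (l : T -> I) :
  (forall p p', l p = l p' -> rho p = rho p') ->
  \sum_p rho p * mean a (fiber l (l p)) = \sum_p rho p * a p.
Proof.
move=> rhoP.
rewrite (partition_big l predT) //= [RHS](partition_big l predT) //=.
apply: eq_bigr => i _.
(* An empty fibre has no point at which to read off the value of [rho]. *)
have [/existsP[p0 /eqP lp0]|/existsPn no] := boolP [exists p, l p == i]; last first.
  by rewrite !big_pred0 // => p; apply/negbTE/no.
rewrite (eq_bigr (fun=> rho p0 * mean a (fiber l i))); last first.
  by move=> p /eqP lp; rewrite lp (rhoP _ p0) // lp lp0.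
rewrite [RHS](eq_bigr (fun p => rho p0 * a p)); last first.
  by move=> p /eqP lp; rewrite (rhoP _ p0) // lp lp0.
rewrite sumr_const -mulr_natl mulrCA -[RHS]mulr_sumr; congr (_ * _).
transitivity (#|fiber l i|%:R * mean a (fiber l i)).
  by congr (_%:R * _); apply: eq_card => p; rewrite inE.
by rewrite -sum_mean; apply: eq_bigl => p; rewrite inE.
Qed.

(** Because [rho] is constant on fibres, [a] can be replaced by its fibre means in the energy;
    [clip_max] then applies to each summand. *)
Lemma energy_max (R : realType) (T I : finType) (D : R) (a rho : T -> R)
    (l : T -> I) :
  (forall p p', l p = l p' -> rho p = rho p') -> (forall p, `|rho p| <= D) ->
  energy a rho <= energy a (clipped_mean D a l).
Proof.
move=> rhoP rhoD.
have E r : (forall p p', l p = l p' -> r p = r p') ->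
    energy a r = \sum_p (2 * r p * mean a (fiber l (l p)) - r p ^+ 2).
  move=> rP; rewrite /energy !sumrB; congr (_ - _).
  under eq_bigr do rewrite -mulrA.
  under [RHS]eq_bigr do rewrite -mulrA.
  by rewrite -!mulr_sumr sum_fiber_mean.
rewrite !E //; last by move=> p p' ll; rewrite /clipped_mean ll.
by apply: ler_sum => p _; apply: clip_max.
Qed.

Lemma energy_le (R : realType) (T : finType) (D : R) (a rho : T -> R) :
  (forall p, `|rho p| <= D) -> energy a rho <= 2 * D * \sum_p `|a p|.
Proof.
move=> rhoD; rewrite mulr_sumr; apply: ler_sum => p _.
have h : rho p * a p <= D * `|a p|.
  by apply: le_trans (ler_norm _) _; rewrite normrM ler_wpM2r.
have := sqr_ge0 (rho p); nra.
Qed.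

(** The bound [D - e] makes clipping trivial on [J] and leaves room for a shift by [e]. With [u] the
    difference of the two means, shifting by [e * sg u] on [f B] gains [#|f B| (2 e |u| - e^2)], at
    least [e^2 #|f B|]. The explicit form of [rho] lets one check later on which partitions it is
    constant. *)
Lemma energy_gain (R : realType) (T I : finType) (D e : R) (a : T -> R)
    (l : T -> I) (J : {set I}) (f : I -> {set T}) :
  0 < e ->
  (forall B, B \in J -> [/\ f B \subset fiber l B,
     `|mean a (fiber l B)| <= D - e &
     e <= `|mean a (f B) - mean a (fiber l B)|]) ->
  exists s : I -> R,
    let rho p := clipped_mean D a l p +
      (if (l p \in J) && (p \in f (l p)) then s (l p) else 0) in
    (0 <= D -> forall p, `|rho p| <= D) /\
    energy a (clipped_mean D a l) + e ^+ 2 * \sum_(B in J) #|f B|%:R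
      <= energy a rho.
Proof.
move=> e0 fP.
pose u B := mean a (f B) - mean a (fiber l B).
exists (fun B => e * Num.sg (u B)) => rho; split.
  move=> D0 p; rewrite /rho; case: ifP => [/andP[pJ _]|_]; last first.
    by rewrite addr0; apply: clip_bound.
  have [_ mD _] := fP _ pJ.
  apply: le_trans (ler_normD _ _) _.
  rewrite /clipped_mean clip_id; last by apply: le_trans mD _; lra.
  rewrite (normrM e) gtr0_norm // normr_sg.
  by case: eqP => _ /=; rewrite ?mulr1 ?mulr0; lra.
rewrite addrC -lerBrDr /energy -sumrB.
pose G p : R := 2 * rho p * a p - rho p ^+ 2 -
  (2 * clipped_mean D a l p * a p - clipped_mean D a l p ^+ 2).
rewrite -/(\sum_p G p).
have -> : \sum_p G p = \sum_(p | l p \in J) G p.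
  rewrite [RHS]big_mkcond; apply: eq_bigr => p _; case: ifPn => // pJ.
  by rewrite /G /rho (negbTE pJ) /= addr0 subrr.
rewrite (partition_big l (mem J)) //= mulr_sumr; apply: ler_sum => B BJ.
have [fB mD uB] := fP _ BJ.
have -> : \sum_(p | (l p \in J) && (l p == B)) G p = \sum_(p in f B)
    (2 * (e * Num.sg (u B)) * a p -
     (2 * (e * Num.sg (u B)) * mean a (fiber l B) + (e * Num.sg (u B)) ^+ 2)).
  rewrite big_mkcond [RHS]big_mkcond; apply: eq_bigr => p _.
  have [lp|lp] := eqVneq (l p) B; last first.
    rewrite andbF; case: ifP => // /(subsetP fB).
    by rewrite inE (negbTE lp).
  rewrite lp BJ /= /G /rho /clipped_mean lp BJ /= clip_id; last first.
    by apply: le_trans mD _; lra.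
  by case: ifP => _; ring.
rewrite sumrB -mulr_sumr sum_mean sumr_const -[X in _ - X]mulr_natl.
have sgu : Num.sg (u B) * u B = `|u B| by rewrite normrEsg.
have sg2 : Num.sg (u B) ^+ 2 = 1.
  by rewrite sqr_sg -normr_gt0 (lt_le_trans e0 uB).
rewrite exprMn sg2.
have -> : forall k M m : R, M - m = u B ->
    2 * (e * Num.sg (u B)) * (k * M) - k * (2 * (e * Num.sg (u B)) * m + e ^+ 2 * 1)
    = k * (2 * e * `|u B| - e ^+ 2).
  by move=> k M m E; rewrite -sgu -E; ring.
  rewrite mulrC ler_wpM2l ?ler0n //; rewrite -/(u B) in uB; nra.
by [].
Qed.

(** * Cells and equitable refinements *)

(* The classes of [P] together with the singletons outside [cover P]. *)
Definition cell (T : finType) (P : {set {set T}}) (x : T) : {set T} :=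
  x |: pblock P x.

Lemma cell_mem (T : finType) (P : {set {set T}}) (X : {set T}) (x : T) :
  trivIset P -> X \in P -> (cell P x == X) = (x \in X).
Proof.
move=> tP XP; apply/eqP/idP => [<-|xX]; first by rewrite setU11.
by rewrite /cell (def_pblock tP XP xX) (setUidPr _) // sub1set.
Qed.

Lemma cell_eq (T : finType) (P : {set {set T}}) (x y : T) :
  cell P x = cell P y -> x = y \/ exists2 X, X \in P & (x \in X) && (y \in X).
Proof.
move=> E; have : x \in cell P y by rewrite -E setU11.
rewrite !inE => /predU1P[->|xy]; first by left.
(* [pblock P y] is empty for uncovered [y], so it cannot contain [x]. *)
have yc : y \in cover P.
  move: xy; rewrite /pblock; case: pickP => [X /andP[XP yX] _|_] /=.
    by apply/bigcupP; exists X.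
  by rewrite inE.
right; exists (pblock P y); first exact: pblock_mem.
by rewrite xy mem_pblock.
Qed.

(** Take a maximal disjoint family of [c]-element subsets of [S] on which the colouring [g] is
    constant. A colour with more than [c] uncovered points would supply one more such subset. *)
Lemma equitable_refinement (T C : finType) (S : {set T}) (K : {set C})
    (g : T -> C) (c : nat) : (0 < c)%N ->
  {in S, forall x, g x \in K} ->
  exists P : {set {set T}}, [/\ trivIset P, forall X, X \in P -> #|X| = c,
    cover P \subset S, (#|S :\: cover P| <= #|K| * c)%N &
    forall x y, cell P x = cell P y -> g x = g y].
Proof.
move=> c0 gK.
pose good (X : {set T}) := [&& #|X| == c, X \subset S &
  [forall x in X, forall y in X, g x == g y]].
pose ok (P : {set {set T}}) := trivIset P && [forall X in P, good X].
have ok0 : ok set0.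
  apply/andP; split; last by apply/forallP => X; rewrite inE.
  by apply/trivIsetP => X Y; rewrite inE.
have [P /maxsetP[/andP[tP /forall_inP gP] maxP] _] := maxset_exists ok0.
have PS : cover P \subset S.
  by apply/bigcupsP => X /gP /and3P[].
exists P; split => //.
- by move=> X /gP /and3P[/eqP].
- rewrite -sum1_card (partition_big g (mem K)) /=; last first.
    by move=> x; rewrite inE => /andP[_ /gK].
  rewrite -sum_nat_const; apply: leq_sum => i iK.
  rewrite sum1_card leqNgt; apply/negP => big.
  pose U := [set x in S :\: cover P | g x == i].
  have cU : (c <= #|U|)%N.
    apply: leq_trans (ltnW big) _; apply: eq_leq; apply: eq_card => x.
    by rewrite [RHS]inE.
  have [s [us ss sU]] := card_geqP cU.
  pose Z := [set x in s].
  have ZU x : x \in Z -> [/\ x \notin cover P, x \in S & g x = i].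
    by rewrite inE => /sU; rewrite !inE -andbA => /and3P[? ? /eqP].
  have cZ : #|Z| = c.
    by rewrite -ss -(card_uniqP us); apply: eq_card => x; rewrite inE.
  have Zdisj : {in P, forall B : {set T}, [disjoint Z & B]}.
    move=> B BP; rewrite disjoints_subset; apply/subsetP => x /ZU[xP _ _].
    by rewrite inE; apply: contra xP => xB; apply/bigcupP; exists B.
  have P0 : set0 \notin P.
    apply/negP => /gP /and3P[/eqP c0']; move: c0.
    by rewrite -c0' cards0.
  have [tZP /negP[]] := trivIsetU1 Zdisj tP P0.
  rewrite -(maxP (Z |: P)) ?setU11 ?subsetUr //.
  rewrite /ok tZP; apply/forall_inP => X /setU1P[->|/gP//].
  rewrite /good cZ eqxx /=; apply/andP; split; first by apply/subsetP => x /ZU[].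
  apply/forall_inP => x /ZU[_ _ ->].
  by apply/forall_inP => y /ZU[_ _ ->].
move=> x y /cell_eq[->//|[X /gP /and3P[_ _ /forall_inP gX] /andP[xX yX]]].
by move/forall_inP: (gX _ xX) => /(_ _ yX) /eqP.
Qed.

(** * Matrices and a single energy increment *)

Lemma sum_norm_mean (R : realType) (T I : finType) (a : T -> R) (l : T -> I)
    (J : {set I}) :
  \sum_(i in J) #|fiber l i|%:R * `|mean a (fiber l i)| <= \sum_p `|a p|.
Proof.
rewrite [leRHS](partition_big l predT) //= [leLHS]big_mkcond /=.
apply: ler_sum => i _; case: ifP => _; last exact: sumr_ge0.
rewrite -[X in X * _]normr_nat -normrM -sum_mean.
apply: le_trans (ler_norm_sum _ _ _) _.
by rewrite le_eqVlt; apply/predU1l/eq_bigl => p; rewrite inE.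
Qed.

Definition entry (R : realType) (m n : nat) (A : 'M[R]_(m, n)) (p : 'I_m * 'I_n) : R :=
  A p.1 p.2.

Definition cell2 (T : finType) (P : {set {set T}}) (p : T * T) : {set T} * {set T} :=
  (cell P p.1, cell P p.2).

Definition partition_energy (R : realType) (D : R) (n : nat) (A : 'M[R]_n)
    (P : {set {set 'I_n}}) : R :=
  energy (entry A) (clipped_mean D (entry A) (cell2 P)).

Definition irregular (R : realType) (e : R) (n : nat) (A : 'M[R]_n)
    (P : {set {set 'I_n}}) : {set {set 'I_n} * {set 'I_n}} :=
  [set XY in setX P P | ~~ regular_block e A XY.1 XY.2].

Lemma density_mean (R : realType) (m n : nat) (A : 'M[R]_(m, n)) X Y :
  density A X Y = mean (entry A) (setX X Y).
Proof.
rewrite /density /mean cardsX pair_big_dep /=; congr (_ * _).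
by apply: eq_bigl => p; rewrite inE.
Qed.

Lemma sum_entry (R : realType) (m n : nat) (A : 'M[R]_(m, n)) :
  \sum_p `|entry A p| = l1norm A.
Proof. by rewrite /l1norm pair_bigA. Qed.

Lemma fiber_cell2 (T : finType) (P : {set {set T}}) (B : {set T} * {set T}) :
  trivIset P -> B \in setX P P -> fiber (cell2 P) B = setX B.1 B.2.
Proof.
case: B => X Y tP; rewrite in_setX => /= /andP[XP YP].
by apply/setP => -[x y]; rewrite !inE xpair_eqE /= !cell_mem.
Qed.

Lemma irregular_witness (R : realType) (e : R) (n : nat) (A : 'M[R]_n)
    (P : {set {set 'I_n}}) :
  exists f : {set 'I_n} * {set 'I_n} -> {set 'I_n} * {set 'I_n},
    forall B, B \in irregular e A P ->
      [/\ (f B).1 \subset B.1, (f B).2 \subset B.2,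
          e * #|B.1|%:R <= #|(f B).1|%:R, e * #|B.2|%:R <= #|(f B).2|%:R &
          e < `|density A (f B).1 (f B).2 - density A B.1 B.2|].
Proof.
(* Finite choice wants a value at every pair, so membership moves under the existential; [B] itself
   serves off the irregular set. *)
suff H B : exists Z : {set 'I_n} * {set 'I_n}, B \in irregular e A P ->
    [/\ Z.1 \subset B.1, Z.2 \subset B.2,
        e * #|B.1|%:R <= #|Z.1|%:R, e * #|B.2|%:R <= #|Z.2|%:R &
        e < `|density A Z.1 Z.2 - density A B.1 B.2|].
  exact: fin_all_exists H.
have [BJ|BJ] := boolP (B \in irregular e A P); last by exists B.
move: BJ; rewrite inE => /andP[_ /forallPn[X /forallPn[Y]]].
rewrite negb_imply -ltNge => /andP[/and4P[? ? ? ?] ?].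
by exists (X, Y).
Qed.

(** In units of [n^2], irregular blocks have area at least [e / 4] and those with mean above [8 / e]
    at most [e / 8]. The remaining [e / 8] contains witnesses of relative area at least [e^2], and
    each witness point gains [e^2]; this gives [e^5 / 8]. *)
Lemma index_refine (R : realType) (e : R) (n : nat) (A : 'M[R]_n)
    (P : {set {set 'I_n}}) (m c : nat) :
  let D := 8 / e + e in
  0 < e -> l1norm A <= (n * n)%:R -> trivIset P ->
  (forall X, X \in P -> #|X| = m) -> (n <= 2 * (#|P| * m))%N ->
  e * (#|P| * #|P|)%:R <= #|irregular e A P|%:R -> (0 < c)%N ->
  exists P' : {set {set 'I_n}}, [/\ trivIset P', forall X, X \in P' -> #|X| = c,
    (#|~: cover P'| <= #|~: cover P| + #|P| * (2 ^ #|P| * 2 ^ #|P|) * c)%N &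
    partition_energy D A P + e ^+ 5 / 8 * (n * n)%:R <= partition_energy D A P'].
Proof.
move=> D e0 An tP Pm nP irr c0.
have [f fP] := irregular_witness e A P.
set J0 := irregular e A P in irr fP.
pose d B := mean (entry A) (fiber (cell2 P) B).
pose J := [set B in J0 | `|d B| <= 8 / e].
have JP B : B \in J0 -> (B.1 \in P) && (B.2 \in P).
  by rewrite 2!inE => /andP[/andP[]] -> ->.
have J0P B : B \in J0 -> B \in setX P P by rewrite inE => /andP[].
pose F B := setX (f B).1 (f B).2.
have FP B : B \in J -> [/\ F B \subset fiber (cell2 P) B,
     `|mean (entry A) (fiber (cell2 P) B)| <= D - e &
     e <= `|mean (entry A) (F B) - mean (entry A) (fiber (cell2 P) B)|].
  rewrite inE => /andP[BJ dB]; have [f1 f2 _ _ ff] := fP _ BJ.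
  rewrite /D addrK; split => //.
    rewrite fiber_cell2 ?J0P //; apply/subsetP => p; rewrite !inE.
    by case/andP => /(subsetP f1) -> /(subsetP f2) ->.
  by rewrite fiber_cell2 ?J0P // -!density_mean ltW.
have [s [] ] := energy_gain e0 FP.
set rho := (fun p => clipped_mean _ _ _ p + _) => rhoD gain.
(* The colour of [x] records its class and every row or column witness containing it, so there are
   at most [#|P| * 2^#|P| * 2^#|P|] colours on the cover. *)
pose g (x : 'I_n) := (cell P x, ([set Y in P | x \in (f (cell P x, Y)).1],
                                 [set X in P | x \in (f (X, cell P x)).2])).
pose K := setX P (setX (powerset P) (powerset P)).
have gK : {in cover P, forall x, g x \in K}.
  move=> x /bigcupP[X XP xX]; rewrite !inE /=.
  have /eqP -> : cell P x == X by rewrite cell_mem.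
  apply/and3P; split => //.
  - by apply/subsetP => Y; rewrite inE => /andP[].
  - by apply/subsetP => Y; rewrite inE => /andP[].
have [P' [tP' cP' sP' rP' gP']] := equitable_refinement c0 gK.
exists P'; split => //.
  have -> : ~: cover P' = ~: cover P :|: (cover P :\: cover P').
    apply/setP => x; rewrite !inE; have := subsetP sP' x.
    by case: (x \in cover P') => //= [->|_]; rewrite ?andbF // orNb.
  apply: leq_trans (leq_card_setU _ _) _; rewrite leq_add2l.
  by apply: leq_trans rP' _; rewrite !cardsX !card_powerset.
have rhoP p p' : cell2 P' p = cell2 P' p' -> rho p = rho p'.
  case: p => x y; case: p' => x' y' [/gP' gx /gP' gy].
  have [px py] : cell P x = cell P x' /\ cell P y = cell P y' by case: gx; case: gy.
  rewrite /rho /clipped_mean /cell2 /= px py; congr (_ + _).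
  (* Off [J] the shift vanishes on both sides; on [J] both sides of the block are classes, so [g]
     determines membership in the witness. *)
  have [BJ|//] := boolP ((cell P x', cell P y') \in J).
  have : (cell P x', cell P y') \in J0 by move: BJ; rewrite inE => /andP[].
  move/JP => /= /andP[XP YP].
  move: gx => [_ /setP/(_ (cell P y')) + _]; rewrite !inE YP px /= => E1.
  move: gy => [_ _ /setP/(_ (cell P x'))]; rewrite !inE XP py /= => E2.
  by rewrite E1 E2.
have D0 : 0 <= D by rewrite addr_ge0 ?divr_ge0 // ltW.
have up := energy_max (entry A) rhoP (rhoD D0); rewrite /partition_energy.
apply: le_trans up.
apply: le_trans gain; rewrite lerD2l.
(* Each block outside [J] carries absolute mass at least [m^2 * 8 / e], out of a total of at most
   [n^2]. *)
have large : #|J0 :\: J|%:R * (m * m)%:R * (8 / e) <= (n * n)%:R :> R.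
  apply: le_trans An; rewrite -sum_entry.
  apply: le_trans (sum_norm_mean (entry A) (cell2 P) (J0 :\: J)).
  rewrite -mulrA mulr_natl -sumr_const; apply: ler_sum => B.
  rewrite inE => /andP[+ BJ]; rewrite inE BJ /= -ltNge => /ltW dB.
  rewrite /d fiber_cell2 ?J0P // in dB *; rewrite cardsX; have /andP[/Pm -> /Pm ->] := JP _ BJ.
  by rewrite ler_wpM2l.
have small : #|J|%:R * (e ^+ 2 * (m * m)%:R) <= \sum_(B in J) #|F B|%:R.
  rewrite mulr_natl -sumr_const; apply: ler_sum => B; rewrite inE => /andP[BJ _].
  have [_ _ f1 f2 _] := fP _ BJ.
  have /andP[/Pm m1 /Pm m2] := JP _ BJ.
  rewrite m1 in f1; rewrite m2 in f2; rewrite cardsX !natrM.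
  have -> : e ^+ 2 * (m%:R * m%:R) = (e * m%:R) * (e * m%:R) by ring.
  by apply: ler_pM; rewrite // mulr_ge0 // ltW.
have JJ : (#|J0 :\: J|%:R + #|J|%:R = #|J0|%:R :> R).
  rewrite -natrD; congr (_%:R); rewrite addnC -(cardsID J J0); congr (_ + _)%N.
  by apply: eq_card => B; rewrite in_setI [B \in J]inE andbA andbb.
have n4 : (n * n)%:R <= 4 * ((#|P| * #|P|)%:R * (m * m)%:R) :> R.
  have -> : 4 * ((#|P| * #|P|)%:R * (m * m)%:R) =
      (2 * (#|P| * m) * (2 * (#|P| * m)))%:R :> R by rewrite !natrM; ring.
  by rewrite ler_nat leq_mul.
have half : e * (n * n)%:R / 8 <= #|J|%:R * (m * m)%:R.
  have {}large : #|J0 :\: J|%:R * (m * m)%:R <= e * (n * n)%:R / 8 :> R.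
    have -> : #|J0 :\: J|%:R * (m * m)%:R =
      e / 8 * (#|J0 :\: J|%:R * (m * m)%:R * (8 / e)) :> R by field; rewrite gt_eqF.
    have -> : e * (n * n)%:R / 8 = e / 8 * (n * n)%:R by ring.
    by rewrite ler_wpM2l // divr_ge0 // ltW.
  have {}irr : e * (#|P| * #|P|)%:R * (m * m)%:R <= #|J0|%:R * (m * m)%:R.
    by rewrite ler_wpM2r.
  rewrite -JJ mulrDl in irr.
  have {}n4 : e * (n * n)%:R <= 4 * (e * (#|P| * #|P|)%:R * (m * m)%:R).
    by rewrite -mulrA [leRHS]mulrCA ler_wpM2l // ltW.
  lra.
have -> : e ^+ 5 / 8 * (n * n)%:R = e ^+ 2 * (e ^+ 2 * (e * (n * n)%:R / 8)).
  by field.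
rewrite ler_wpM2l ?sqr_ge0 //; apply: le_trans small.
by rewrite [leRHS]mulrCA ler_wpM2l ?sqr_ge0.
Qed.

(** * Class counts and the iteration *)

(* [q] times a bound for the number of cells into which [k] classes are cut. *)
Definition cell_bound (q k : nat) : nat := (q * (k * (2 ^ k * 2 ^ k)))%N.

(** Bounds the classes after [j] increments: pieces of size [n %/ N] number at most [2 N], with
    [N = q] at the start and [N = cell_bound q _] afterwards. *)
Fixpoint class_bound (q j : nat) : nat :=
  if j is j'.+1 then (2 * cell_bound q (class_bound q j'))%N else (2 * q)%N.

Lemma cell_bound_mono (q : nat) : {homo cell_bound q : k l / (k <= l)%N}.
Proof. by move=> k l kl; rewrite /cell_bound !leq_mul ?leq_pexp2l. Qed.

Lemma class_bound_gt0 (q j : nat) : (0 < q)%N -> (0 < class_bound q j)%N.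
Proof.
by move=> q0; elim: j => [|j IH] /=; rewrite /cell_bound !muln_gt0 ?q0 ?IH ?expn_gt0.
Qed.

Lemma class_bound_mono (q : nat) : (0 < q)%N ->
  {homo class_bound q : i j / (i <= j)%N}.
Proof.
move=> q0; apply: homo_leq => // [i j k|j] /=; first exact: leq_trans.
set b := class_bound q j; rewrite /cell_bound.
have x0 : (0 < 2 ^ b * 2 ^ b)%N by rewrite muln_gt0 expn_gt0.
apply: leq_trans (leq_pmulr b x0) _.
by apply: leq_trans (leq_pmull _ q0) _; apply: leq_pmull.
Qed.

Lemma floor_bounds (n N : nat) : (0 < N)%N -> (N <= n)%N ->
  [/\ (0 < n %/ N)%N, (N * (n %/ N) <= n)%N & (n <= 2 * (N * (n %/ N)))%N].
Proof.
move=> N0 Nn; have q0 : (0 < n %/ N)%N by rewrite divn_gt0.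
have := divn_eq n N; have := ltn_pmod n N0; move: q0.
by set q := (n %/ N)%N; set r := (n %% N)%N => q0 rN nE; split=> //; nia.
Qed.

Lemma card_equitable (T : finType) (P : {set {set T}}) (c : nat) :
  trivIset P -> (forall X, X \in P -> #|X| = c) ->
  (#|~: cover P| + #|P| * c)%N = #|T|.
Proof.
move=> tP cP; rewrite -(cardsC (cover P)) addnC; congr (_ + _)%N.
have [_] := leq_card_cover P; rewrite tP => /eqP ->.
by rewrite -sum_nat_const; apply: eq_bigr => X /cP.
Qed.

(** The assumption [e <= 1/2] keeps at least half of the points in classes throughout, as
    [index_refine] requires. *)
Lemma regular_existence (R : realType) (e : R) (L : nat) : 0 < e -> e <= 2^-1 ->
  exists M : nat, (0 < M)%N /\
    forall n : nat, (M <= n)%N -> forall A : 'M[R]_n, l1norm A <= (n * n)%:R ->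
      exists P : {set {set 'I_n}}, exists m : nat,
        [/\ trivIset P, (0 < m)%N, forall X, X \in P -> #|X| = m,
            #|~: cover P|%:R < e * n%:R &
            #|irregular e A P|%:R <= e * (#|P| * #|P|)%:R /\ (L <= #|P| <= M)%N].
Proof.
move=> e0 e2; pose D := 8 / e + e.
have D0 : 0 < D by rewrite addr_gt0 ?divr_gt0.
pose dl := e ^+ 5 / 8.
have dl0 : 0 < dl by rewrite divr_gt0 // exprn_gt0.
(* The energy never exceeds [2 D n^2], so [t] increments of [dl n^2] are impossible. *)
have [t tP] : exists t : nat, 2 * D < dl * t%:R.
  exists (Num.bound (2 * D / dl)); rewrite [ltRHS]mulrC -ltr_pdivrMr //.
  by apply: archi_boundP; rewrite divr_ge0 // ltW // mulr_gt0.
have [q0 q0P] : exists q0 : nat, t.+1%:R < e * q0%:R.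
  exists (Num.bound (t.+1%:R / e)); rewrite [ltRHS]mulrC -ltr_pdivrMr //.
  by apply: archi_boundP; rewrite divr_ge0 // ltW.
(* [q0] keeps [t + 1] losses of [n / q] points below [e n], [2 * L] ensures at least [L] classes,
   and [1] makes [q] positive. *)
pose q := (q0 + 2 * L + 1)%N.
have qgt0 : (0 < q)%N by rewrite /q addn1.
have qL : (2 * L <= q)%N by rewrite /q; lia.
have qP : t.+1%:R < e * q%:R.
  by apply: lt_le_trans q0P _; rewrite ler_wpM2l ?ler_nat ?(ltW e0) // /q; lia.
exists (class_bound q t); split; first exact: class_bound_gt0.
move=> n Mn A An.
have n0 : (0 < n)%N by apply: leq_trans (class_bound_gt0 t qgt0) Mn.
set goal := (ex _).
(* State after [j] increments without success; the [j.+1] counts the loss in the initial cutting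
   too. *)
pose inv j := exists P : {set {set 'I_n}}, exists m : nat,
  [/\ trivIset P, (0 < m)%N, forall X, X \in P -> #|X| = m,
      (q * #|~: cover P| <= j.+1 * n)%N & (L <= #|P| <= class_bound q j)%N /\
      dl * j%:R * (n * n)%:R <= partition_energy D A P].
have except j x : (j <= t)%N -> (q * x <= j.+1 * n)%N -> x%:R < e * n%:R.
  move=> jt xj; have qR : 0 < q%:R :> R by rewrite ltr0n.
  rewrite -(ltr_pM2l qR) mulrCA -natrM.
  apply: (@le_lt_trans _ _ (t.+1%:R * n%:R)).
    by rewrite -natrM ler_nat (leq_trans xj) // leq_mul2r ltnS jt orbT.
  by rewrite mulrA ltr_pM2r ?ltr0n.
have covered (P : {set {set 'I_n}}) m j : (j <= t)%N -> trivIset P ->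
    (forall X, X \in P -> #|X| = m) -> (q * #|~: cover P| <= j.+1 * n)%N ->
    (n <= 2 * (#|P| * m))%N.
  move=> jt tP' Pm /(except _ _ jt) ex.
  have : (2 * #|~: cover P| <= n)%N.
    rewrite -(ler_nat R) natrM; have : 0 <= n%:R :> R by []; nra.
  by have := card_equitable tP' Pm; rewrite card_ord; lia.
(* Cutting into pieces of size [n %/ N] where [N] is [q] times the number of
   cells loses at most [n / q] points and leaves at least [N / 2] classes. *)
have count (P : {set {set 'I_n}}) j N : (j <= t)%N -> (q <= N <= n)%N ->
    trivIset P -> (forall X, X \in P -> #|X| = (n %/ N)%N) ->
    (q * #|~: cover P| <= j.+1 * n)%N -> (L <= #|P| <= 2 * N)%N.
  move=> jt /andP[qN Nn] tP' Pm ex.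
  have N0 : (0 < N)%N by apply: leq_trans qN.
  have [c0 c1 c2] := floor_bounds N0 Nn.
  have := card_equitable tP' Pm; rewrite card_ord.
  have := covered _ _ _ jt tP' Pm ex.
  move: c0 c1 c2; set c := (n %/ N)%N; set k := #|P|; set v := #|~: _|.
  move=> c0 c1 c2 h1 h2; apply/andP; split.
    have : (N * c <= 2 * k * c)%N by lia.
    by rewrite leq_pmul2r //; lia.
  have : (k * c <= 2 * N * c)%N by lia.
  by rewrite leq_pmul2r.
have main j : (j <= t)%N -> goal \/ inv j.
  elim: j => [_|j IH jt].
    right.
    have qn : (q <= n)%N.
      by have := class_bound_mono qgt0 (leq0n t); rewrite /=; lia.
    have [c0 c1 _] := floor_bounds qgt0 qn.
    (* A single colour: the initial partition is an arbitrary equitable cutting. *)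
    have gK : {in [set: 'I_n], forall x, tt \in [set tt]}.
      by move=> x _; rewrite inE.
    have [P [tP' cP _ rP _]] := equitable_refinement c0 gK.
    have ex : (q * #|~: cover P| <= 1 * n)%N.
      by move: rP; rewrite setTD cards1; nia.
    exists P, (n %/ q)%N; split => //; split.
      by apply: (count _ _ _ (leq0n t) _ tP' cP ex); rewrite leqnn.
    rewrite mulr0 mul0r.
    (* Comparison with [rho = 0] shows that the initial energy is nonnegative. *)
    have := @energy_max R _ _ D (entry A) (fun=> 0) (cell2 P).
    rewrite {1}/energy big1 => [|p _]; last by rewrite mulr0 mul0r expr0n subrr.
    by apply=> // p; rewrite normr0 ltW.
  have [|[P [m [tP' m0 Pm ex [/andP[LP PB] iP]]]]] := IH (ltnW jt); first by left.
  have [reg|irr] := leP #|irregular e A P|%:R (e * (#|P| * #|P|)%:R).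
    left; exists P, m; split => //; first exact: (except j _ (ltnW jt)).
    split => //.
    by rewrite LP (leq_trans PB) // class_bound_mono // ltnW.
  right.
  (* [K] bounds the number of colours. The existentials make [K] and [N] opaque. *)
  have [K KE] : exists K, K = cell_bound 1 (class_bound q j) by eexists.
  have [N NE] : exists N, N = cell_bound q (class_bound q j) by eexists.
  have NK : N = (q * K)%N by rewrite NE KE /cell_bound mul1n.
  have K0 : (0 < K)%N.
    by rewrite KE /cell_bound !muln_gt0 class_bound_gt0 // expn_gt0.
  have Nn : (q <= N <= n)%N.
    rewrite {1}NK leq_pmulr //=; apply: leq_trans Mn.
    apply: leq_trans (class_bound_mono qgt0 jt) => /=.
    by rewrite -NE; apply: leq_pmull.
  have N0 : (0 < N)%N by rewrite NK muln_gt0 qgt0.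
  have [c0 c1 _] := floor_bounds N0 (proj2 (andP Nn)).
  have [P' [tP'' cP' eP' iP']] := index_refine e0 An tP' Pm
    (covered _ _ _ (ltnW jt) tP' Pm ex) (ltW irr) c0.
  (* The new loss is at most [K * (n %/ N)], and [q * K = N] turns it into at most [n]. *)
  have ex' : (q * #|~: cover P'| <= j.+2 * n)%N.
    have := cell_bound_mono 1 PB; rewrite -KE /cell_bound mul1n => KK.
    have : (q * #|~: cover P'| <= q * (#|~: cover P| + K * (n %/ N)))%N.
      by rewrite leq_mul2l (leq_trans eP') ?orbT // leq_add2l leq_mul2r KK orbT.
    by move=> h; apply: leq_trans h _; rewrite mulnDr mulnA -NK (mulSn j.+1) addnC leq_add.
  exists P', (n %/ N)%N; split => //; split.
    by have := count _ _ _ jt Nn tP'' cP' ex'; rewrite NE.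
  apply: le_trans iP'; rewrite -natr1 mulrDr mulr1 mulrDl lerD2r.
  exact: iP.
have [//|[P [m [_ _ _ _ [_ iP]]]]] := main t (leqnn t).
have := @energy_le R _ D (entry A) (clipped_mean D (entry A) (cell2 P)).
rewrite -/(partition_energy D A P) sum_entry => iD.
have {}iD : partition_energy D A P <= 2 * D * (n * n)%:R.
  apply: le_trans (iD _) _; first by move=> p; apply/clip_bound/ltW.
  by rewrite ler_wpM2l // mulr_ge0 // ltW.
have := le_trans iP iD; rewrite ler_pM2r ?ltr0n ?muln_gt0 ?n0 //.
by rewrite leNgt tP.
Qed.

(** * Monotonicity, normalisation and the theorem *)

Lemma regular_block_mono (R : realType) (e eps : R) (m n : nat)
    (A : 'M[R]_(m, n)) X Y : e <= eps ->
  regular_block e A X Y -> regular_block eps A X Y.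
Proof.
move=> ee /forallP H; apply/forallP => X'; apply/forallP => Y'.
apply/implyP => /and4P[XX YY cX cY].
have := implyP (forallP (H X') Y'); rewrite XX YY /=.
have le (k : nat) : e * k%:R <= eps * k%:R by rewrite ler_wpM2r.
by rewrite (le_trans (le _) cX) (le_trans (le _) cY) => /(_ isT)/le_trans; apply.
Qed.

(** Equality holds unless the norm of [A] is zero, when division by zero makes the left side [0]. *)
Lemma l1norm_normalized (R : realType) (m n : nat) (A : 'M[R]_(m, n)) :
  l1norm (normalized A) <= (m * n)%:R.
Proof.
have A0 : 0 <= l1norm A by do 2!apply: sumr_ge0 => ? _.
rewrite /normalized /l1norm.
under eq_bigr do under eq_bigr do rewrite mxE normrM.
under eq_bigr do rewrite -mulr_sumr.
rewrite -mulr_sumr -/(l1norm A) ger0_norm ?divr_ge0 //.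
by have [->|An] := eqVneq (l1norm A) 0; rewrite ?mulr0 // mulfVK.
Qed.

Theorem theorem4 (R : realType) (eps : R) (L : nat)
    (eps_gt0 : 0 < eps) (L_gt0 : (0 < L)%N) :
  exists M : nat, (0 < M)%N /\
    forall n : nat, (M <= n)%N -> forall A : 'M[R]_n,
      exists B : block_partition n n,
        [/\ symmetric_partition B,
            normalized_regular_partition eps A B &
            (L <= #|classes B.1| <= M)%N].
Proof.
(* Regularity for the smaller parameter [e] implies it for [eps]. *)
pose e := Num.min eps 2^-1.
have e0 : 0 < e by rewrite lt_min eps_gt0 invr_gt0 ltr0n.
have ee : e <= eps by rewrite ge_min lexx.
have [|M [M0 HM]] := regular_existence L e0; first by rewrite ge_min lexx orbT.
exists M; split=> // n Mn A.
have [P [m [tP m0 Pm ex [irr LM]]]] := HM n Mn _ (l1norm_normalized A).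
have pP : partition P (~: ~: cover P).
  rewrite /partition setCK eqxx tP /=; apply/negP => /Pm.
  by rewrite cards0 => m0'; rewrite -m0' in m0.
exists (XPartition pP, XPartition pP); split=> //.
have ex' : #|~: cover P|%:R < eps * n%:R :> R.
  by apply: lt_le_trans ex _; rewrite ler_wpM2r.
have bP : balanced (XPartition pP) by move=> X Y /Pm -> /Pm ->.
split=> //=; apply: le_trans (le_trans irr _); last by rewrite ler_wpM2r.
rewrite ler_nat; apply: subset_leq_card; apply/subsetP => B.
rewrite !inE /= => /andP[-> nr] /=.
by apply: contra nr; apply: regular_block_mono.
Qed.
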